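(* Every pre-Lie algebra is a pre-Malcev algebra. That is, let $A$ be a vector space over a field with a bilinear product $\cdot$ satisfying the left-symmetric identity $$(x,y,z)-(y,x,z)=0\qquad\text{for all }x,y,z\in A,\quad\text{where }(x,y,z)=(x\cdot y)\cdot z-x\cdot(y\cdot z).$$ Then $PM(x,y,z,t)=0$ for all $x,y,z,t\in A$.
   Context: A pre-Malcev algebra is a vector space $A$ with a bilinear product $\cdot$ satisfying $PM(x,y,z,t)=0$ for all $x,y,z,t\in A$, where $$\begin{aligned}PM(x,y,z,t)={}&(y\cdot z)\cdot(x\cdot t)-(z\cdot y)\cdot(x\cdot t)\\&+((x\cdot y)\cdot z)\cdot t-((y\cdot x)\cdot z)\cdot t-(z\cdot(x\cdot y))\cdot t+(z\cdot(y\cdot x))\cdot t\\&+y\cdot((x\cdot z)\cdot t)-y\cdot((z\cdot x)\cdot t)-x\cdot(y\cdot(z\cdot t))+z\cdot(x\cdot(y\cdot t)).\end{aligned}$$ A pre-Lie algebra is a vector space with a bilinear product satisfying the left-symmetric identity. *)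

(* Defs.v *)
From HB Require Import structures.
From mathcomp Require Import all_boot all_order all_algebra.

Set Implicit Arguments.
Unset Strict Implicit.
Unset Printing Implicit Defensive.

Import GRing.Theory.
Local Open Scope ring_scope.

(* An algebra is an arbitrary F-vector space A (of any dimension) together
   with a bilinear product mu : {bilinear A -> A -> A}, neither associative
   nor unital. *)
Section Algebras.

Variables (F : fieldType) (A : lmodType F) (mu : {bilinear A -> A -> A}).

Local Notation "x ⋅ y" := (mu x y) (at level 40, left associativity).

Definition associator (x y z : A) : A := (x ⋅ y) ⋅ z - x ⋅ (y ⋅ z).

Definition pre_Lie : Prop :=
  forall x y z : A, associator x y z - associator y x z = 0.

Definition PM (x y z t : A) : A :=
    (y ⋅ z) ⋅ (x ⋅ t) - (z ⋅ y) ⋅ (x ⋅ t)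
  + ((x ⋅ y) ⋅ z) ⋅ t - ((y ⋅ x) ⋅ z) ⋅ t
  - (z ⋅ (x ⋅ y)) ⋅ t + (z ⋅ (y ⋅ x)) ⋅ t
  + y ⋅ ((x ⋅ z) ⋅ t) - y ⋅ ((z ⋅ x) ⋅ t)
  - x ⋅ (y ⋅ (z ⋅ t)) + z ⋅ (x ⋅ (y ⋅ t)).

Definition pre_Malcev : Prop := forall x y z t : A, PM x y z t = 0.

End Algebras.

(* Main.v *)
Require Import Defs.
From HB Require Import structures.
From mathcomp Require Import all_boot all_order all_algebra.

Set Implicit Arguments.
Unset Strict Implicit.
Unset Printing Implicit Defensive.

Import GRing.Theory.
Local Open Scope ring_scope.

(* The left-symmetric identity says that L_[x,y] = [L_x, L_y] for the left
   multiplications. As an operator on t, PM x y z reads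
   L_[y,z] L_x + L_[[x,y],z] + L_y L_[x,z] - L_x L_y L_z + L_z L_x L_y,
   so every term becomes a word in L_x, L_y, L_z and the words cancel. *)

Section LeftMultiplication.

Variables (F : fieldType) (A : lmodType F) (mu : {bilinear A -> A -> A}).

Definition commutator (x y : A) : A := mu x y - mu y x.

Lemma pre_Lie_commutator : pre_Lie mu ->
  forall x y z, mu (commutator x y) z = mu x (mu y z) - mu y (mu x z).
Proof.
move=> muL x y z; rewrite /commutator linearBl.
have /eqP := muL x y z.
rewrite /associator subr_eq0 subr_eq => /eqP ->.
(* The substitution for [mu (mu x y) z] brings in a copy of [mu (mu y x) z], which cancels against
   the subtracted one. *)
by rewrite [LHS](ACl (3*2*1*4)) /= addrK.
Qed.

(** Bilinearity groups the first eight terms of [PM] into brackets; the last two are already words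
    in left multiplications. *)
Lemma PM_commutator x y z t :
  PM mu x y z t =
    mu (commutator y z) (mu x t) + mu (commutator (commutator x y) z) t
    + mu y (mu (commutator x z) t)
    - mu x (mu y (mu z t)) + mu z (mu x (mu y t)).
Proof.
(* [opprB] reverses the difference from the outer bracket, hence the swap of terms 5 and 6. *)
by rewrite /PM /commutator !(linearBl, linearBr) /= !opprB !addrA
  [in RHS](ACl (1*2*3*4*6*5*7*8*9*10)).
Qed.

End LeftMultiplication.

Theorem mainTheorem1 (F : fieldType) (A : lmodType F)
    (mu : {bilinear A -> A -> A}) :
  pre_Lie mu -> pre_Malcev mu.
Proof.
move=> /pre_Lie_commutator LE x y z t.
rewrite PM_commutator !LE !linearBr /= !opprB !addrA.
(* The pairs are the words yzx, zyx, xyz, yxz, zxy applied to [t], each occurring once with either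
   sign. *)
rewrite [LHS](ACl ((1*8)*(5*2)*(3*9)*(7*4)*(10*6))) /=.
by rewrite !subrr !addr0.
Qed.
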